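(* Let $p\in[1,\infty)$ and let $q\in L_1^{\rm loc}(\mathbb R)$, $q\ge0$. Then the equation $$-y'(x)+q(x)y(x)=f(x),\quad x\in\mathbb R,$$ is correctly solvable in $L_p(\mathbb R)$ if and only if $\int_{-\infty}^{\infty}q(t)\,dt=\infty$ and $d_0<\infty$ (equivalently, $q_0^*>0$), where $$d_0=\sup_{x\in\mathbb R}d(x),\qquad q_0^*=\inf_{x\in\mathbb R}q^*(x).$$
   Context: Solutions: a solution of $-y'+qy=f$ is an absolutely continuous function (i.e. absolutely continuous on every bounded interval) $y$ on $\mathbb R$ satisfying the equation almost everywhere on $\mathbb R$. Correct solvability: the equation is correctly solvable in $L_p=L_p(\mathbb R)$ if (i) for any $f\in L_p$ it has a unique solution $y\in L_p$; (ii) there is a constant $c(p)\in(0,\infty)$, independent of $f$, such that for every $f\in L_p$ this solution $y\in L_p$ satisfies $\|y\|_p\le c(p)\|f\|_p$. The functions $d$ and $q^*$: when $\int_{-\infty}^\infty q(t)\,dt=\infty$, set $d(x)=\inf\{d\ge0:\int_{x-d}^{x+d}q(\xi)\,d\xi=2\}$ and $q^*(x)=1/d(x)$ for $x\in\mathbb R$; the condition $d_0<\infty$ is considered only when this divergence condition holds, so that $d$ is well defined. *)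

(* Defs.v *)
From HB Require Import structures.
From mathcomp Require Import all_boot all_order all_algebra.
From mathcomp Require Import all_classical all_reals all_analysis.

Set Implicit Arguments.
Unset Strict Implicit.
Unset Printing Implicit Defensive.
Import Order.TTheory GRing.Theory Num.Theory.
Import numFieldNormedType.Exports.

Local Open Scope classical_set_scope.
Local Open Scope ring_scope.

Definition absolutely_continuous_on (R : realType) (a b : R) (y : R -> R) :
    Prop :=
  forall e : R, 0 < e -> exists2 delta : R, 0 < delta &
    forall (n : nat) (u v : 'I_n -> R),
      (forall i, [/\ a <= u i, u i <= v i & v i <= b]) ->
      trivIset [set: 'I_n] (fun i => [set` `]u i, v i[]) ->
      \sum_(i < n) (v i - u i) < delta ->
      \sum_(i < n) `|y (v i) - y (u i)| < e.

Definition locally_absolutely_continuous (R : realType) (y : R -> R) : Prop :=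
  forall a b : R, absolutely_continuous_on a b y.

(* [derive1] is total, so differentiability has to be required explicitly. *)
Definition is_solution (R : realType) (q f y : R -> R) : Prop :=
  locally_absolutely_continuous y /\
  {ae (@lebesgue_measure R), forall x : R,
     derivable y x 1 /\ - derive1 y x + q x * y x = f x}.

(* Elements of L_p are represented by functions in [Lfun]. Changing [f] on a
   null set does not change the solutions, and solutions are continuous
   functions, so uniqueness is pointwise equality. *)
Definition correctly_solvable (R : realType) (p : R) (q : R -> R) : Prop :=
  let mu := @lebesgue_measure R in
  (forall f : R -> R, f \in Lfun mu p%:E ->
     exists! y : R -> R, y \in Lfun mu p%:E /\ is_solution q f y) /\
  (exists2 c : R, 0 < c &
     forall f y : R -> R, f \in Lfun mu p%:E ->
       y \in Lfun mu p%:E -> is_solution q f y ->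
       (Lnorm mu p%:E (EFin \o y) <= c%:E * Lnorm mu p%:E (EFin \o f))%E).

Definition diverges (R : realType) (q : R -> R) : Prop :=
  (\int[@lebesgue_measure R]_t (q t)%:E = +oo)%E.

(* Meaningful only under [diverges q]: otherwise the set may be empty, and
   [inf set0 = 0]. *)
Definition d_fun (R : realType) (q : R -> R) (x : R) : R :=
  inf [set d : R | 0 <= d /\
    (\int[@lebesgue_measure R]_(xi in `[(x - d)%R, (x + d)%R]) (q xi)%:E
      = 2%:E)%E].

Definition qstar (R : realType) (q : R -> R) (x : R) : R := (d_fun q x)^-1.

Definition d0 (R : realType) (q : R -> R) : \bar R :=
  ereal_sup (range (fun x : R => (d_fun q x)%:E)).

Definition qstar0 (R : realType) (q : R -> R) : \bar R :=
  ereal_inf (range (fun x : R => (qstar q x)%:E)).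

(* Main.v *)
(** Let [Q] be a primitive of [q]; the solutions of the homogeneous equation are
    the multiples of [e^Q].

    Necessity only uses the norm estimate.  If [q] has integral at most [A] on
    [x - d, x + d], then [e^Q] oscillates there by a factor at most [e^A], so
    testing the estimate on [y = e^Q * tent], where [tent] is supported on that
    interval and has slopes 1 and -1, for which [f = - e^Q * tent'], gives
    [d <= 4 c e^A].  With [A] the total integral of [q] this forces divergence,
    and with [A = 2] it bounds the half-length function.

    Conversely, if every interval of half-length [D] carries at least 2 units of
    [q], then [Q t - Q x >= (t - x) / D - 2] for [x <= t].  Hence
    [y x = e^(Q x) * int_x^oo e^(- Q t) f t dt] is dominated by [e^2 D] times the
    average of [|f|] against a one-sided exponential probability kernel, and
    Jensen's inequality and Tonelli's theorem give
    [||y||_p <= e^2 D ||f||_p].  Uniqueness holds because [e^Q >= 1] on the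
    positive half-line. *)

Require Import Defs.
From HB Require Import structures.
From mathcomp Require Import all_boot all_order all_algebra.
From mathcomp Require Import all_classical all_reals all_analysis.
From mathcomp Require Import measurable_realfun ring lra.
Import Order.TTheory GRing.Theory Num.Theory.
Import numFieldNormedType.Exports.
Local Open Scope classical_set_scope.
Local Open Scope ring_scope.

(** * Absolutely continuous functions *)

Section AbsolutelyContinuous.
Context {R : realType}.
Implicit Types (y w : R -> R).

(** Common source of the closure properties below: Lipschitz maps, differences, products and
    exponentials all have increments dominated by those of two functions already known to be
    absolutely continuous. *)
Lemma ac_lipschitz_comb (a b C : R) (y y1 y2 : R -> R) :
  absolutely_continuous_on a b y1 -> absolutely_continuous_on a b y2 ->
  (forall u v, a <= u -> u <= v -> v <= b ->
     `|y v - y u| <= C * (`|y1 v - y1 u| + `|y2 v - y2 u|)) ->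
  absolutely_continuous_on a b y.
Proof.
move=> ac1 ac2 H e e0.
(* No sign is assumed for [C], so a positive majorant replaces it; each of the two sums then gets
   the budget [e / (2 * K)]. *)
pose K := `|C| + 1.
have K0 : 0 < K by rewrite ltr_wpDl.
have e'0 : 0 < e / (2 * K) by rewrite divr_gt0// mulr_gt0.
have [d1 d10 D1] := ac1 _ e'0.
have [d2 d20 D2] := ac2 _ e'0.
exists (Num.min d1 d2); first by rewrite lt_min d10.
move=> n u v uv tuv; rewrite lt_min => /andP[s1 s2].
have {}D1 := D1 _ _ _ uv tuv s1.
have {}D2 := D2 _ _ _ uv tuv s2.
apply: (@le_lt_trans _ _
  (K * (\sum_(i < n) `|y1 (v i) - y1 (u i)| + \sum_(i < n) `|y2 (v i) - y2 (u i)|))).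
  rewrite -big_split/= mulr_sumr ler_sum// => i _.
  have [au uv' vb] := uv i.
  apply: (le_trans (H _ _ au uv' vb)); rewrite ler_wpM2r ?addr_ge0//.
  by rewrite (le_trans (ler_norm C))// /K lerDl.
rewrite -ltr_pdivlMl// (lt_le_trans (ltrD D1 D2))//.
by rewrite le_eqVlt; apply/orP; left; apply/eqP; field; rewrite gt_eqF.
Qed.

Lemma ac_id (a b : R) : absolutely_continuous_on a b id.
Proof.
move=> e e0; exists e => // n u v uv _ s.
rewrite (eq_bigr (fun i => v i - u i))// => i _.
by have [_ ? _] := uv i; rewrite ger0_norm// subr_ge0.
Qed.

Lemma locally_ac_lipschitz (C : R) y :
  (forall u v, `|y v - y u| <= C * `|v - u|) -> locally_absolutely_continuous y.
Proof.
move=> H a b; apply: (@ac_lipschitz_comb a b C y id (cst 0)).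
- exact: ac_id.
- apply: (@ac_lipschitz_comb a b 0 _ id id); [exact: ac_id|exact: ac_id|].
  by move=> *; rewrite subrr normr0 mul0r.
- by move=> u v _ _ _; rewrite subrr normr0 addr0.
Qed.

Lemma locally_acB y1 y2 : locally_absolutely_continuous y1 ->
  locally_absolutely_continuous y2 ->
  locally_absolutely_continuous (y1 \- y2).
Proof.
move=> h1 h2 a b; apply: (@ac_lipschitz_comb a b 1 _ y1 y2) => // u v _ _ _ /=.
by rewrite mul1r [X in `|X|](_ : _ = (y1 v - y1 u) - (y2 v - y2 u)) ?ler_normB//; ring.
Qed.

Lemma locally_ac_continuous y : locally_absolutely_continuous y -> continuous y.
Proof.
move=> acy x; apply/cvgrPdist_lt => e e0.
have [d d0 D] := acy (x - 1) (x + 1) _ e0.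
have key u v : x - 1 <= u -> u <= v -> v <= x + 1 -> v - u < d ->
    `|y v - y u| < e.
  move=> xu uv vx vud.
  have := D 1%N (fun=> u) (fun=> v); rewrite !big_ord1; apply => //.
  by move=> i j _ _ _; rewrite (ord1 i) (ord1 j).
exists (Num.min d 1) => /=; first by rewrite lt_min d0 ltr01.
move=> t /=; rewrite lt_min => /andP[td t1].
have [xt|/ltW tx] := leP x t.
- rewrite distrC; apply: key => //; move: td t1; rewrite distrC ger0_norm ?subr_ge0//.
  + by move=> *; lra.
  + by move=> *; lra.
- apply: key => //; move: td t1; rewrite ger0_norm ?subr_ge0//; move=> *; lra.
Qed.

Lemma continuous_bounded_itv (a b : R) y : continuous y ->
  exists2 M, 0 <= M & forall x, a <= x <= b -> `|y x| <= M.
Proof.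
move=> cy; have [ab|ba] := leP a b; last first.
  by exists 0 => // x /andP[ax xb]; have := lt_le_trans ba (le_trans ax xb); rewrite ltxx.
have cn : {within `[a, b], continuous (fun x => `|y x|)}.
  apply: continuous_subspaceT => x.
  by apply: (@continuous_comp _ _ _ y Num.norm); [exact: cy|exact: norm_continuous].
have [c _ H] := EVT_max ab cn.
by exists `|y c| => // x xab; apply: H; rewrite in_itv.
Qed.

Lemma locally_acM y1 y2 : locally_absolutely_continuous y1 ->
  locally_absolutely_continuous y2 ->
  locally_absolutely_continuous (y1 \* y2).
Proof.
move=> h1 h2 a b.
have [M1 M10 H1] := continuous_bounded_itv a b _ (locally_ac_continuous _ h1).
have [M2 M20 H2] := continuous_bounded_itv a b _ (locally_ac_continuous _ h2).
apply: (@ac_lipschitz_comb a b (M1 + M2) _ y1 y2) => // u v au uv vb /=.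
(* Discrete product rule; the undifferenced factors are bounded on [[a, b]] by [M1] and [M2]. *)
have -> : y1 v * y2 v - y1 u * y2 u =
  y1 v * (y2 v - y2 u) + (y1 v - y1 u) * y2 u by ring.
apply: (le_trans (ler_normD _ _)); rewrite !normrM.
have y1v : `|y1 v| <= M1 by rewrite H1// vb (le_trans au).
have y2u : `|y2 u| <= M2 by rewrite H2// au (le_trans uv).
have n1 := normr_ge0 (y1 v - y1 u).
have n2 := normr_ge0 (y2 v - y2 u).
nra.
Qed.

(** For [u <= v], factor out [expR v] and apply [1 + z <= expR z] at [z = u - v]. *)
Lemma expR_lipschitz (M u v : R) : u <= M -> v <= M ->
  `|expR v - expR u| <= expR M * `|v - u|.
Proof.
wlog uv : u v / u <= v.
  move=> W uM vM; have [uv|/ltW vu] := leP u v; first exact: W.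
  by rewrite distrC [X in _ * X]distrC; exact: W.
move=> uM vM; rewrite !ger0_norm ?subr_ge0 ?ler_expR//.
have -> : expR u = expR v * expR (u - v) by rewrite -expRD; congr expR; ring.
have := expR_ge1Dx (u - v).
have := expR_gt0 v.
have : expR v <= expR M by rewrite ler_expR.
by move=> *; nra.
Qed.

Lemma locally_ac_expR y : locally_absolutely_continuous y ->
  locally_absolutely_continuous (expR \o y).
Proof.
move=> h a b.
have [M M0 H] := continuous_bounded_itv a b _ (locally_ac_continuous _ h).
apply: (@ac_lipschitz_comb a b (expR M) _ y y) => // u v au uv vb /=.
have yu : y u <= M by rewrite (le_trans (ler_norm _))// H// au (le_trans uv).
have yv : y v <= M by rewrite (le_trans (ler_norm _))// H// vb (le_trans au).
apply: (le_trans (expR_lipschitz M _ _ yu yv)).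
by rewrite ler_wpM2l ?expR_ge0// lerDl.
Qed.

End AbsolutelyContinuous.

(** * Absolutely continuous functions whose derivative vanishes almost everywhere *)

Section ZeroDerivative.
Context {R : realType}.
Notation mu := (@lebesgue_measure R).

(** Let [T] be the supremum of the points of [[a, b]] satisfying [C]. The step at [T] carries [C]
    from a nearby point on the left to [T], and then past [T] unless [T = b]. *)
Lemma real_induction (a b : R) (C : R -> Prop) : a <= b -> C a ->
  (forall x, a <= x <= b -> exists2 r, 0 < r &
     forall s t, a <= s -> x - r < s -> s <= x -> x <= t -> t < x + r ->
       t <= b -> C s -> C t) ->
  C b.
Proof.
move=> ab Ca step.
pose S := [set t | a <= t <= b /\ C t].
have Sa : S a by split => //; rewrite lexx.
have ubS : ubound S b by move=> t [/andP[]].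
have hS : has_sup S by split; [exists a|exists b].
have aT : a <= sup S by apply: ub_le_sup => //; exists b.
have Tb : sup S <= b by apply: ge_sup => //; exists a.
have [|r r0 Hr] := step (sup S); first by rewrite aT.
have [s [/andP[as_ sb] Cs] Ts] := sup_adherent r0 hS.
have sT : s <= sup S by apply: ub_le_sup; [exists b|split => //; rewrite as_].
have CT : C (sup S) by apply: (Hr s) => //; rewrite ltrDl.
have [Tb'|bT] := ltP (sup S) b; last first.
  by have -> : b = sup S by apply/eqP; rewrite eq_le bT.
pose t := Num.min b (sup S + r / 2).
have Tt : sup S < t by rewrite lt_min Tb' ltrDl divr_gt0.
have tb : t <= b by rewrite ge_min lexx.
have tr : t < sup S + r.
  by rewrite gt_min; apply/orP; right; rewrite ltrD2l ltr_pdivrMr// ltr_pMr// ltr1n.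
have Ct : C t by apply: (Hr (sup S)) => //; rewrite ?ltrBlDr ?ltrDl// ltW.
have : t <= sup S.
  by apply: ub_le_sup; [exists b|split => //; rewrite tb (le_trans aT) ?ltW].
by rewrite leNgt Tt.
Qed.

Lemma derive10_near (w : R -> R) (x e : R) : 0 < e ->
  derivable w x 1 -> derive1 w x = 0 -> exists2 r, 0 < r &
    forall t, `|t - x| < r -> `|w t - w x| <= e * `|t - x|.
Proof.
move=> e0 dw w0.
have : h^-1 *: (w (h + x) - w x) @[h --> 0^'] --> (0 : R).
  move: dw; rewrite /derivable => /cvg_ex[l]; rewrite /= => hl.
  have : lim (h^-1 *: (w (h *: 1 + x) - w x) @[h --> 0^']) = l by apply: cvg_lim.
  have E : (fun h => h^-1 *: (w (h + x) - w x)) = (fun h => h^-1 *: (w (h *: 1 + x) - w x)).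
    by apply/funext => h; rewrite [h *: 1]mulr1.
  rewrite -E in hl * => Hl.
  move: w0; rewrite /derive1 Hl => l0; move: hl; rewrite l0; exact.
move=> /cvgrPdist_lt /(_ e e0)[r /= r0 Hr].
exists r => // t tr.
have [->|tx] := eqVneq t x; first by rewrite !subrr normr0 mulr0.
have tx0 : 0 < `|t - x| by rewrite normr_gt0 subr_eq0.
have := Hr (t - x); rewrite /= !sub0r !normrN subrK => /(_ tr).
rewrite subr_eq0 => /(_ tx).
rewrite normrZ normfV => /ltW.
by rewrite mulrC ler_pdivrMr.
Qed.

(* The null set where [w' = 0] fails is covered by an open set of small measure;
   a Cousin-type induction splits [a, b] into intervals on which [w] is nearly
   constant and intervals contained in that open set. *)
Lemma ac_derive0_const (a b : R) (w : R -> R) : a <= b ->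
  absolutely_continuous_on a b w ->
  {ae mu, forall x, derivable w x 1 /\ derive1 w x = 0} ->
  w b = w a.
Proof.
move=> ab acw [N [mN N0 HN]].
(* The term [e * (b - a)] pays for the intervals where [w] is nearly constant, the last [e] for
   those inside the small open set. *)
suff H : forall e, 0 < e -> `|w b - w a| <= e * (b - a) + e.
  apply/eqP; rewrite -subr_eq0 -normr_le0; apply/ler_addgt0Pl => e e0.
  rewrite addr0.
  have k0 : 0 < b - a + 1 by rewrite ltr_wpDl// subr_ge0.
  have := H _ (divr_gt0 e0 k0).
  rewrite (_ : _ * _ + _ = e)//; field; rewrite gt_eqF//.
move=> e e0.
have [d d0 Hd] := acw e e0.
have N0' : mu N = 0%E by exact: N0.
have [|U [oU NU Ud]] := lebesgue_regularity_outer mN _ d0; first by rewrite [ltLHS]N0'.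
have mU : measurable U by apply: open_measurable.
have {}Ud : (mu U < d%:E)%E.
  apply: le_lt_trans Ud.
  have -> : mu U = mu (U `&` N `|` (U `\` N)) by rewrite setUIDK.
  apply: (le_trans (measureU2 _ _ _)); [exact: measurableI|exact: measurableD|].
  rewrite [X in (X + _)%E](_ : _ = 0%E) ?add0e//.
  apply/eqP; rewrite eq_le measure_ge0 andbT -N0' le_measure// inE//.
  exact: measurableI.
(* Only the intervals lying in [U] are recorded, in increasing order; the nearly constant ones have
   already been absorbed into [e * (t - a)]. *)
pose C t := exists n (u v : nat -> R), [/\
  (forall i, (i < n)%N -> [/\ a <= u i, u i <= v i, v i <= t & [set` `]u i, v i[] `<=` U]),
  (forall i j, (i < j)%N -> (j < n)%N -> v i <= u j) &
  `|w t - w a| <= e * (t - a) + \sum_(i < n) `|w (v i) - w (u i)|].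
have : C b.
  apply: (real_induction a b C ab).
    by exists 0%N, (fun=> a), (fun=> a); split => //; rewrite big_ord0 !subrr normr0 mulr0 addr0.
  move=> x xab.
  (* A point of [N] has a neighbourhood inside [U]. At any other point the derivative is 0, and
     comparing [w s] and [w t] with [w x] costs [e * (x - s) + e * (t - x)]. *)
  have gauge : exists2 r, 0 < r &
      forall s t, x - r < s -> s <= x -> x <= t -> t < x + r ->
      `|w t - w s| <= e * (t - s) \/ [set` `]s, t[] `<=` U.
    have [xN|xN] := pselect (N x).
      have /nbhs_ballP[r /= r0 xr] : nbhs x U by apply: open_nbhs_nbhs; split=> //; exact: NU.
      exists r => // s t xs sx xt tx; right => z /=; rewrite in_itv/= => /andP[sz zt].
      by apply: xr; rewrite /ball/= ltr_distlC; apply/andP; split; lra.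
    have [dx wx] : derivable w x 1 /\ derive1 w x = 0.
      by apply: contrapT => h; apply: xN; apply: HN.
    have [r r0 Hr] := derive10_near _ _ _ e0 dx wx.
    exists r => // s t xs sx xt tx; left.
    have h1 := Hr s; have h2 := Hr t.
    have sr : `|s - x| < r by rewrite ltr_norml; apply/andP; split; lra.
    have tr : `|t - x| < r by rewrite ltr_norml; apply/andP; split; lra.
    have -> : w t - w s = (w t - w x) - (w s - w x) by ring.
    apply: (le_trans (ler_normB _ _)).
    apply: (le_trans (lerD (h2 tr) (h1 sr))).
    by rewrite ger0_norm ?subr_ge0// ler0_norm ?subr_le0//; lra.
  have [r r0 Hr] := gauge; exists r => // s t as_ xs sx xt tx tb [n [u [v [uv dis Hs]]]].
  have st : s <= t by lra.
  have [g|bad] := Hr s t xs sx xt tx.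
    exists n, u, v; split => //.
      by move=> i /uv[? ? ? ?]; split => //; lra.
    have -> : w t - w a = (w t - w s) + (w s - w a) by ring.
    by apply: (le_trans (ler_normD _ _)); lra.
  (* The new interval lies in [U] and is appended at index [n]; it starts at [s], to the right of
     all earlier ones. *)
  exists n.+1, (fun i => if (i < n)%N then u i else s), (fun i => if (i < n)%N then v i else t).
  split.
  - move=> i; rewrite ltnS => _; case: ifPn => // /uv[? ? ? ?]; split => //; lra.
  - move=> i j ij; rewrite ltnS => jn.
    have iN : (i < n)%N by exact: leq_trans jn.
    rewrite iN; case: ifPn => [jn'|_]; first exact: dis.
    by have [] := uv i iN.
  - rewrite big_ord_recr/= ltnn.
    under eq_bigr do rewrite ltn_ord.
    have -> : w t - w a = (w t - w s) + (w s - w a) by ring.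
    apply: (le_trans (ler_normD _ _)).
    have : e * (s - a) <= e * (t - a) by rewrite ler_wpM2l ?(ltW e0)//; lra.
    by lra.
move=> [n [u [v [uv dis Hb]]]].
have tI : trivIset [set: 'I_n] (fun i : 'I_n => [set` `]u i, v i[]).
  have lt_disj (i j : 'I_n) z : (i < j)%N -> z \in `]u i, v i[ -> z \in `]u j, v j[ -> False.
    move=> ij; rewrite !in_itv/= => /andP[_ zv] /andP[uz _].
    have := dis i j ij (ltn_ord j); lra.
  move=> i j _ _ [z [/= zi zj]].
  have [ij|ji|/val_inj//] := ltngtP i j; exfalso.
  - exact: (lt_disj _ _ z ij).
  - exact: (lt_disj _ _ z ji).
apply: (le_trans Hb); rewrite lerD2l; apply: ltW.
apply: (Hd n (fun i => u i) (fun i => v i)) => //.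
  by move=> i; have [] := uv i (ltn_ord i).
rewrite -lte_fin; apply: le_lt_trans Ud.
rewrite -sumEFin.
have -> : (\sum_(i < n) (v i - u i)%:E = \sum_(i < n) mu [set` `]u i, v i[])%E.
  apply: eq_bigr => i _; rewrite lebesgue_measure_itv/= lte_fin.
  have [_ uvi _ _] := uv i (ltn_ord i).
  by case: ltgtP uvi => // ->; rewrite subrr.
have := @measure_bigsetU_ord _ _ _ mu n predT (fun i : 'I_n => [set` `]u i, v i[]).
rewrite /= => <- //.
apply: le_measure; rewrite ?inE//.
  by apply: bigsetU_measurable => i _; exact: measurable_itv.
apply: (big_ind (fun A => A `<=` U)) => //.
  by move=> A B AU BU z [/AU|/BU].
by move=> i _; have [] := uv i (ltn_ord i).
Qed.

End ZeroDerivative.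

(** * Primitives of locally integrable functions *)

Section Primitive.
Context {R : realType}.
Notation mu := (@lebesgue_measure R).
Implicit Types (g : R -> R) (a b x : R).

Lemma locally_integrable_itv g a b : locally_integrable [set: R] g ->
  mu.-integrable `[a, b] (EFin \o g).
Proof.
move=> [mg _ ig]; apply/integrableP; split.
  by apply/measurable_EFinP; exact: measurable_funTS.
by apply: ig => //; exact: segment_compact.
Qed.

Lemma Rintegral_itv_cat g a b c : locally_integrable [set: R] g ->
  a <= b -> b <= c ->
  \int[mu]_(t in `[a, c]) g t =
  \int[mu]_(t in `[a, b]) g t + \int[mu]_(t in `[b, c]) g t.
Proof.
move=> lg ab bc; apply/eqP; rewrite addrC -subr_eq; apply/eqP.
rewrite Rintegral_itvB ?bnd_simp//; last exact: locally_integrable_itv.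
rewrite Rintegral_itv_obnd_cbnd//.
apply: integrableS (locally_integrable_itv g b c lg) => //.
by apply: subset_itvr; rewrite bnd_simp.
Qed.

(** Signed integral of [g] from 0 to [x]: at least one of the two terms vanishes, according to the
    sign of [x]. *)
Definition prim g x :=
  \int[mu]_(t in `[0, x]) g t - \int[mu]_(t in `[x, 0]) g t.

Lemma Rintegral_itv_ge_eq0 g a b : b <= a -> \int[mu]_(t in `[a, b]) g t = 0.
Proof.
rewrite le_eqVlt => /predU1P[->|ba]; first by rewrite set_itv1 Rintegral_set1.
by rewrite set_itv_ge ?Rintegral_set0// bnd_simp -ltNge.
Qed.

Lemma primB g a b : locally_integrable [set: R] g -> a <= b ->
  prim g b - prim g a = \int[mu]_(t in `[a, b]) g t.
Proof.
move=> lg ab; rewrite /prim.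
have [a0|a0] := leP 0 a.
  have b0 := le_trans a0 ab.
  by rewrite (Rintegral_itv_ge_eq0 g b 0)// (Rintegral_itv_ge_eq0 g a 0)// (Rintegral_itv_cat g 0 a b)//; ring.
have [b0|b0] := leP 0 b.
  by rewrite (Rintegral_itv_ge_eq0 g b 0)// (Rintegral_itv_ge_eq0 g 0 a) ?(ltW a0)// (Rintegral_itv_cat g a 0 b) ?(ltW a0)//; ring.
rewrite (Rintegral_itv_ge_eq0 g 0 b) ?(ltW b0)// (Rintegral_itv_ge_eq0 g 0 a) ?(ltW a0)//.
by rewrite (Rintegral_itv_cat g a b 0) ?(ltW b0)//; ring.
Qed.

(** Restricting [g] to [[a, b]] gives a function integrable on the line; the absolute continuity of
    its integral is applied to the union of the given intervals. *)
Lemma prim_ac g : locally_integrable [set: R] g ->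
  locally_absolutely_continuous (prim g).
Proof.
move=> lg a b e e0.
pose h := g \_ `[a, b].
have ih : mu.-integrable setT (EFin \o h).
  rewrite /h -restrict_EFin; apply/integrable_restrict => //=; rewrite setTI.
  exact: locally_integrable_itv.
have [d [d0 Hd]] := integral_normr_continuous ih e0.
exists d => // n u v uv tuv s.
pose U := \big[setU/set0]_(i < n) [set` `]u i, v i[].
have mU : measurable U by apply: bigsetU_measurable => i _; exact: measurable_itv.
have mUE : mu U = (\sum_(i < n) (v i - u i))%:E.
  rewrite /U (measure_bigsetU_ord _ predT)//=.
  rewrite -sumEFin; apply: eq_bigr => i _; rewrite lebesgue_measure_itv/= lte_fin.
  have [_ uvi _] := uv i.
  by case: ltgtP uvi => // ->; rewrite subrr.
apply: le_lt_trans (Hd U mU _); last by rewrite [ltLHS]mUE lte_fin.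
have ih' A : measurable A -> mu.-integrable A (EFin \o (fun x => `|h x|)).
  move=> mA; apply: (@integrableS _ _ _ _ setT) => //.
  exact: integrable_norm.
have hE : \int[mu]_(x in U) `|h x| = \sum_(i < n) \int[mu]_(x in `]u i, v i[) `|h x|.
  rewrite /Rintegral /U integral_bigsetU_EFin//=.
  - by rewrite sum_fine// => i _; apply: integrable_fin_num => //; exact: ih'.
  - exact: index_enum_uniq.
  - by apply: sub_trivIset tuv.
  - by have /integrableP[] := ih' _ mU.
rewrite hE; apply: ler_sum => i _.
have [au uvi vb] := uv i.
rewrite primB//.
apply: (le_trans (le_normr_Rintegral _ _)) => //; first exact: locally_integrable_itv.
rewrite le_eqVlt; apply/orP; left; apply/eqP.
rewrite /Rintegral; congr fine.
(* The increments of [prim] are integrals over closed intervals, the disjoint family is open; the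
   endpoints are null. *)
rewrite -(@integral_itv_bndoo _ (u i) (v i) _ true false); last first.
  by have /integrableP[] := ih' _ (measurable_itv `]u i, v i[).
apply: eq_integral => x; rewrite inE/= in_itv/= => /andP[ux xv].
by rewrite /h patchE ifT// inE/= in_itv/= (le_trans au)// (le_trans xv).
Qed.

(** Near [x], [prim g] differs by the constant [prim g (x - 1)] from the integral based at [x - 1],
    to which Lebesgue's form of the fundamental theorem applies. *)
Lemma lebesgue_pt_prim g x : locally_integrable [set: R] g ->
  lebesgue_pt g x -> is_derive x (1 : R) (prim g) (g x).
Proof.
move=> lg gx.
have xx : x - 1 < x by rewrite ltrBlDr ltrDl.
have xu : x < x + 1 by rewrite ltrDl.
pose I := locally_integrable_itv g (x - 1) (x + 1) lg.
have [|dF F'] := FTC1_lebesgue_pt xu I _ gx; first by rewrite lte_fin.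
pose F y := \int[mu]_(t in [set` Interval (BLeft (x - 1)) (BRight y)]) g t.
have E : \forall y \near x, F y + prim g (x - 1) = prim g y.
  have : \forall y \near x, x - 1 < y by apply: lt_nbhsr.
  apply: filterS => y xy; rewrite /F -primB ?(ltW xy)//; ring.
have dF' : is_derive x (1 : R) F (g x).
  by apply: DeriveDef => //; rewrite -derive1E.
apply: (near_eq_is_derive E).
by rewrite -[g x]addr0; apply: is_deriveD.
Qed.

Lemma prim_derive g : locally_integrable [set: R] g ->
  {ae mu, forall x, is_derive x (1 : R) (prim g) (g x)}.
Proof.
move=> lg; have := lebesgue_differentiation lg.
apply: (@filterS _ _ (ae_filter_ringOfSetsType mu)) => x gx.
exact: lebesgue_pt_prim.
Qed.

End Primitive.

(** * The integrating factor and the homogeneous equation *)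

Section Solutions.
Context {R : realType}.
Notation mu := (@lebesgue_measure R).
Implicit Types (f q y z : R -> R) (a b x : R).

(** Differentiating the factor [expR (prim q x)] cancels the term in [q]. It serves twice: with a
    tent as [phi] for necessity, and with a tail integral for sufficiency. *)
Lemma is_solution_expM q (phi psi : R -> R) : locally_integrable [set: R] q ->
  locally_absolutely_continuous phi ->
  {ae mu, forall x, is_derive x (1 : R) phi (psi x)} ->
  is_solution q (fun x => - (expR (prim q x) * psi x))
                (fun x => expR (prim q x) * phi x).
Proof.
move=> lq acphi dphi; split.
  by apply: (locally_acM (expR \o prim q) phi) => //; apply/locally_ac_expR/prim_ac.
have := prim_derive q lq; move: dphi.
apply: (@filterS2 _ _ (ae_filter_ringOfSetsType mu)) => x dphi dQ.
have dE : is_derive (x : R) (1 : R) (expR \o prim q) (expR (prim q x) * q x).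
  by apply: is_derive1_comp.
have dM := is_deriveM dE dphi.
have -> : (fun x => expR (prim q x) * phi x) = (expR \o prim q) * phi by [].
split; first by case: dM.
by rewrite derive1E; case: dM => _ ->; rewrite /GRing.scale/=; ring.
Qed.

Lemma is_solutionB q f y1 y2 :
  is_solution q f y1 -> is_solution q f y2 ->
  is_solution q (fun=> 0) (y1 \- y2).
Proof.
move=> [ac1 s1] [ac2 s2]; split; first exact: locally_acB.
move: s1 s2.
apply: (@filterS2 _ _ (ae_filter_ringOfSetsType mu)) => x [d1 e1] [d2 e2].
split; first exact: derivableB.
rewrite derive1E [X in - X](_ : _ = 'D_1 y1 x - 'D_1 y2 x); last by rewrite -deriveB.
by rewrite -!derive1E -[RHS](subrr (f x)) -{1}e1 -e2 /=; ring.
Qed.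

Lemma prim0 q : prim q 0 = 0.
Proof. by rewrite /prim subrr. Qed.

(** The quotient of [z] by [expR (prim q x)] is locally absolutely continuous with zero derivative
    almost everywhere, hence constant; [prim q 0 = 0] identifies the constant. *)
Lemma homogeneous_solutionE q z : locally_integrable [set: R] q ->
  is_solution q (fun=> 0) z -> forall x, z x = z 0 * expR (prim q x).
Proof.
move=> lq [acz sz] x.
pose w := z * (expR \o (- prim q)).
have acw : locally_absolutely_continuous w.
  apply: (locally_acM z _) => //; apply: locally_ac_expR.
  have := locally_acB _ _ (locally_ac_lipschitz 0 (cst 0) _) (prim_ac q lq).
  rewrite (_ : cst 0 \- prim q = - prim q); last by apply/funext => t /=; rewrite sub0r.
  by apply=> u v; rewrite subrr normr0 mul0r.
have dw : {ae mu, forall t : R, derivable w t 1 /\ derive1 w t = 0}.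
  have := prim_derive q lq; move: sz.
  apply: (@filterS2 _ _ (ae_filter_ringOfSetsType mu)) => t [dz ez] dQ.
  have dE : is_derive (t : R) (1 : R) (expR \o (- prim q)) (expR (- prim q t) * - q t).
    by apply: is_derive1_comp.
  have dz' : is_derive (t : R) (1 : R) z (q t * z t).
    apply: DeriveDef => //; rewrite -derive1E.
    by move/eqP : ez; rewrite addrC subr_eq0 => /eqP ->.
  have dM := is_deriveM dz' dE.
  split; first by case: dM.
  by rewrite derive1E; case: dM => _ ->; rewrite /GRing.scale/=; ring.
have H a b : a <= b -> w b = w a.
  by move=> ab; apply: ac_derive0_const.
have -> : z x = w x * expR (prim q x).
  by rewrite /w /= -[(z * _) x]/(z x * expR (- prim q x)) -mulrA -expRD addNr expR0 mulr1.
congr (_ * _).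
have -> : z 0 = w 0 by rewrite /w -[RHS]/(z 0 * expR (- prim q 0)) prim0 oppr0 expR0 mulr1.
by have [x0|/ltW x0] := leP x 0; [rewrite (H x 0)|rewrite (H 0 x)].
Qed.

Lemma prim_le q a b : locally_integrable [set: R] q -> (forall x, 0 <= q x) ->
  a <= b -> prim q a <= prim q b.
Proof.
by move=> lq q0 ab; rewrite -subr_ge0 primB//; apply: Rintegral_ge0.
Qed.

Lemma integral_itv_prim q a b : locally_integrable [set: R] q -> a <= b ->
  (\int[mu]_(t in `[a, b]) (q t)%:E = (prim q b - prim q a)%:E)%E.
Proof.
move=> lq ab; rewrite primB// /Rintegral fineK//.
by apply: integrable_fin_num => //; exact: locally_integrable_itv.
Qed.

End Solutions.

(** * Norms of functions on intervals *)

Section Lnorm.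
Context {R : realType}.
Notation mu := (@lebesgue_measure R).
Implicit Types (g : R -> R) (a b M p : R).

Lemma Lnorm_powR p g : Lnorm mu p%:E (EFin \o g) =
  ((\int[mu]_x (`|g x| `^ p)%:E) `^ p^-1)%E.
Proof. by rewrite unlock. Qed.

Lemma Lfun_measurable p g : g \in Lfun mu p%:E -> measurable_fun [set: R] g.
Proof. by rewrite inE => /andP[/[!inE]]. Qed.

Lemma Lfun_lty p g : g \in Lfun mu p%:E -> (Lnorm mu p%:E (EFin \o g) < +oo)%E.
Proof. by rewrite inE => /andP[_ /[!inE]]. Qed.

Lemma mem_Lfun p g : measurable_fun [set: R] g ->
  (Lnorm mu p%:E (EFin \o g) < +oo)%E -> g \in Lfun mu p%:E.
Proof. by move=> mg ng; rewrite inE; apply/andP; split; rewrite inE. Qed.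

Lemma measurable_normr_powR p g (D : set R) : measurable_fun D g ->
  measurable_fun D (fun x => (`|g x| `^ p)%:E).
Proof.
move=> mg; apply/measurable_EFinP.
apply: (measurableT_comp (measurable_powR _)) => //.
exact: measurableT_comp.
Qed.

Lemma integral_itv_cst_powR p a b M : 1 <= p -> 0 <= M -> a <= b ->
  ((\int[mu]_(x in `[a, b]) (M `^ p)%:E) `^ p^-1 = (M * (b - a) `^ p^-1)%:E)%E.
Proof.
move=> p1 M0 ab; have p0 : p != 0 by rewrite gt_eqF// (lt_le_trans ltr01).
have E : (mu `[a, b] = (b - a)%:E)%E.
  rewrite lebesgue_measure_itv/= lte_fin.
  by case: ltgtP ab => // ->; rewrite subrr.
rewrite integral_cst// [X in (_ * X)%E]E -EFinM poweR_EFin powRM ?powR_ge0 ?subr_ge0//.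
by rewrite -powRrM mulfV// powRr1.
Qed.

Lemma Lnorm_le_itv p a b M g : 1 <= p -> 0 <= M -> a <= b ->
  measurable_fun [set: R] g ->
  (forall x, a <= x <= b -> `|g x| <= M) ->
  (forall x, ~~ (a <= x <= b) -> g x = 0) ->
  (Lnorm mu p%:E (EFin \o g) <= (M * (b - a) `^ p^-1)%:E)%E.
Proof.
move=> p1 M0 ab mg gM g0; have p0 : 0 < p by rewrite (lt_le_trans ltr01).
rewrite Lnorm_powR -integral_itv_cst_powR//.
apply: gt0_ler_poweR; rewrite ?invr_ge0 ?(ltW p0)// ?in_itv/= ?leey ?andbT.
- by apply: integral_ge0 => x _; rewrite lee_fin powR_ge0.
- by apply: integral_ge0 => x _; rewrite lee_fin powR_ge0.
rewrite [leRHS]integral_mkcond.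
apply: ge0_le_integral => //.
- exact: measurable_normr_powR.
- by apply/(measurable_restrictT _ _).1.
- move=> x _; rewrite patchE mem_setE in_itv/=; case: ifPn => xab.
    by rewrite lee_fin ge0_ler_powR ?nnegrE ?(ltW p0)// gM.
  by rewrite g0// normr0 powR0// gt_eqF.
Qed.

Lemma Lnorm_ge_itv p a b M g : 1 <= p -> 0 <= M -> a <= b ->
  measurable_fun [set: R] g ->
  (forall x, a <= x <= b -> M <= `|g x|) ->
  ((M * (b - a) `^ p^-1)%:E <= Lnorm mu p%:E (EFin \o g))%E.
Proof.
move=> p1 M0 ab mg gM; have p0 : 0 < p by rewrite (lt_le_trans ltr01).
rewrite Lnorm_powR -integral_itv_cst_powR//.
apply: gt0_ler_poweR; rewrite ?invr_ge0 ?(ltW p0)// ?in_itv/= ?leey ?andbT.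
- by apply: integral_ge0 => x _; rewrite lee_fin powR_ge0.
- by apply: integral_ge0 => x _; rewrite lee_fin powR_ge0.
rewrite [leLHS]integral_mkcond.
apply: ge0_le_integral => //.
- by move=> x _; apply: erestrict_ge0 => y _; rewrite lee_fin powR_ge0.
- by apply/(measurable_restrictT _ _).1.
- exact: measurable_normr_powR.
- move=> x _; rewrite patchE mem_setE in_itv/=; case: ifPn => xab; rewrite lee_fin ?powR_ge0//.
  by rewrite ge0_ler_powR ?nnegrE ?(ltW p0)// gM.
Qed.

End Lnorm.

(** * Necessity *)

Section Necessity.
Context {R : realType}.
Notation mu := (@lebesgue_measure R).
Implicit Types (q : R -> R) (x d : R).

Definition tent x d t : R := Num.max 0 (d - `|t - x|).

(** The derivative of [tent x d] away from its three corners, where the value is set to 0. *)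
Definition tent_slope x d t : R := \1_(`]x - d, x[) t - \1_(`]x, x + d[) t.

Lemma tentE x d t : `|t - x| <= d -> tent x d t = d - `|t - x|.
Proof. by move=> h; rewrite /tent max_r// subr_ge0. Qed.

Lemma tent0 x d t : d <= `|t - x| -> tent x d t = 0.
Proof. by move=> h; rewrite /tent max_l// subr_le0. Qed.

Lemma tent_ac x d : locally_absolutely_continuous (tent x d).
Proof.
apply: (locally_ac_lipschitz 1) => u v; rewrite mul1r.
have : `|v - x| - `|u - x| <= `|v - u|.
  by rewrite (_ : v - u = (v - x) - (u - x)) ?lerB_dist//; ring.
have : `|u - x| - `|v - x| <= `|v - u|.
  by rewrite [leRHS]distrC (_ : u - v = (u - x) - (v - x)) ?lerB_dist//; ring.
have := normr_ge0 (v - u).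
set A := `|v - u|; set B := `|v - x|; set C := `|u - x| => A0 h1 h2.
rewrite /tent -/B -/C ler_norml; apply/andP.
by split; case: (leP (d - B) 0) => hB; case: (leP (d - C) 0) => hC; lra.
Qed.

Lemma tent_slope_abs x d t : `|tent_slope x d t| <= 1.
Proof.
rewrite /tent_slope !indicE !mem_setE !in_itv/=.
by do 2 case: (_ && _); rewrite ?subrr ?subr0 ?sub0r ?normrN ?normr0 ?normr1.
Qed.

Lemma tent_slope0 x d t : 0 <= d -> ~~ (x - d <= t <= x + d) -> tent_slope x d t = 0.
Proof.
move=> d0 h; rewrite /tent_slope !indicE !mem_setE !in_itv/=.
rewrite (_ : _ && _ = false); last by apply/negbTE; apply: contra h => /andP[? ?]; lra.
by rewrite (_ : _ && _ = false) ?subrr//; apply/negbTE; apply: contra h => /andP[? ?]; lra.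
Qed.

Lemma tent_is_derive x d t : 0 < d -> t != x - d -> t != x -> t != x + d ->
  is_derive t (1 : R) (tent x d) (tent_slope x d t).
Proof.
move=> d0 t1 t2 t3.
rewrite /tent_slope !indicE !mem_setE !in_itv/=.
have [tl|lt_t|/eqP] := ltgtP t (x - d); last by rewrite (negbTE t1).
- have tx : t < x by lra.
  rewrite [x < t]ltNge (ltW tx)/= subrr.
  apply: (@near_eq_is_derive _ _ _ (cst 0)).
  have : \forall y \near t, y < x - d by apply: lt_nbhsl.
  by apply: filterS => y yt /=; rewrite tent0// ler0_norm; lra.
have [tx|xt|/eqP] := ltgtP t x; last by rewrite (negbTE t2).
- rewrite subr0.
  apply: (@near_eq_is_derive _ _ _ (fun y => y + (d - x))).
    have h1 : \forall y \near t, y < x by apply: lt_nbhsl.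
    have h2 : \forall y \near t, x - d < y by apply: lt_nbhsr.
    by apply: filterS2 h1 h2 => y y1 y2; rewrite tentE ler0_norm; lra.
  by rewrite -[1%:R]addr0; apply: is_deriveD.
have [td|dt|/eqP] := ltgtP t (x + d); last by rewrite (negbTE t3).
- rewrite sub0r.
  apply: (@near_eq_is_derive _ _ _ (fun y => - y + (d + x))).
    have h1 : \forall y \near t, y < x + d by apply: lt_nbhsl.
    have h2 : \forall y \near t, x < y by apply: lt_nbhsr.
    by apply: filterS2 h1 h2 => y y1 y2; rewrite tentE ger0_norm; lra.
  by rewrite -[- 1%:R]addr0; apply: is_deriveD.
- rewrite subrr.
  apply: (@near_eq_is_derive _ _ _ (cst 0)).
  have : \forall y \near t, x + d < y by apply: lt_nbhsr.
  by apply: filterS => y yt /=; rewrite tent0// ger0_norm; lra.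
Qed.

Lemma tent_derive x d : 0 < d ->
  {ae mu, forall t, is_derive t (1 : R) (tent x d) (tent_slope x d t)}.
Proof.
move=> d0; exists [set x - d; x; x + d]; split => //.
- by do ! apply: measurableU => //.
- apply: countable_lebesgue_measure0.
  by apply: finite_set_countable; do ! rewrite finite_setU; do ! split; exact: finite_set1.
- move=> t /= Ht; apply: contrapT => nt; apply: Ht; apply: tent_is_derive => //;
    by apply/eqP => E; apply: nt; rewrite E; do ?[by left|by right|left].
Qed.

Lemma measurable_tent_slope x d : measurable_fun [set: R] (tent_slope x d).
Proof. by apply: measurable_funB; exact: measurable_indic. Qed.

End Necessity.

(** * Consequences of the norm estimate for tent-shaped solutions *)

Section NecessityBound.
Context {R : realType}.
Notation mu := (@lebesgue_measure R).
Implicit Types (q : R -> R) (x d : R).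

Lemma locally_ac_measurable (y : R -> R) : locally_absolutely_continuous y ->
  measurable_fun [set: R] y.
Proof. by move=> acy; apply: continuous_measurable_fun; exact: locally_ac_continuous. Qed.

(** With [m = expR (prim q (x - d))], the factor [expR (prim q t)] stays between [m] and
    [m * expR A] on the window. So the norm of [f] is at most [m * expR A * (2 * d)]^
    p^-1[, while that of]y[is at least]m * (d / 2) * d [^ p^-1]. *)
Lemma solvable_half_length_le (p c : R) q : 1 <= p ->
  locally_integrable [set: R] q -> (forall x, 0 <= q x) -> 0 < c ->
  (forall f y : R -> R, f \in Lfun mu p%:E -> y \in Lfun mu p%:E ->
     is_solution q f y ->
     (Lnorm mu p%:E (EFin \o y) <= c%:E * Lnorm mu p%:E (EFin \o f))%E) ->
  forall x d A, 0 < d -> prim q (x + d) - prim q (x - d) <= A ->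
    d <= 4 * c * expR A.
Proof.
move=> p1 lq q0 c0 H x d A d0 HA.
have p0 : 0 < p by rewrite (lt_le_trans ltr01).
pose f t := - (expR (prim q t) * tent_slope x d t).
pose y t := expR (prim q t) * tent x d t.
have sol : is_solution q f y.
  by apply: is_solution_expM => //; [exact: tent_ac|exact: tent_derive].
have my : measurable_fun setT y by apply: locally_ac_measurable; case: sol.
have mE : measurable_fun setT (fun t => expR (prim q t)).
  exact: locally_ac_measurable (locally_ac_expR _ (prim_ac q lq)).
have mf : measurable_fun setT f.
  by apply: measurableT_comp => //; apply: measurable_funM => //; exact: measurable_tent_slope.
pose m := expR (prim q (x - d)).
have m0 : 0 < m by exact: expR_gt0.
have xdd : x - d <= x + d by lra.
have Ele t : t <= x + d -> expR (prim q t) <= m * expR A.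
  move=> td; rewrite -expRD ler_expR.
  by have := prim_le q t (x + d) lq q0 td; lra.
have Ege t : x - d <= t -> m <= expR (prim q t).
  by move=> td; rewrite ler_expR prim_le.
have Nf : (Lnorm mu p%:E (EFin \o f) <= (m * expR A * (x + d - (x - d)) `^ p^-1)%:E)%E.
  apply: Lnorm_le_itv => //.
  - by rewrite mulr_ge0 ?expR_ge0.
  - move=> t /andP[t1 t2]; rewrite /f normrN normrM ger0_norm ?expR_ge0//.
    rewrite -[leRHS]mulr1; apply: ler_pM; rewrite ?expR_ge0//.
      exact: Ele.
    exact: tent_slope_abs.
  - by move=> t t1; rewrite /f tent_slope0 ?mulr0 ?oppr0// ltW.
(* This upper bound serves only to place [y] in [Lfun]. *)
have Nyle : (Lnorm mu p%:E (EFin \o y) <= (m * expR A * d * (x + d - (x - d)) `^ p^-1)%:E)%E.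
  apply: Lnorm_le_itv => //.
  - by rewrite !mulr_ge0 ?expR_ge0// ltW.
  - move=> t /andP[t1 t2]; rewrite /y normrM ger0_norm ?expR_ge0//.
    apply: ler_pM; rewrite ?expR_ge0//.
      exact: Ele.
    have td : `|t - x| <= d by rewrite ler_norml; apply/andP; split; lra.
    by rewrite tentE// ger0_norm ?subr_ge0// lerBlDr lerDl.
  - move=> t t1; rewrite /y tent0 ?mulr0// leNgt; apply: contra t1.
    by rewrite ltr_norml => /andP[? ?]; apply/andP; split; lra.
(* On the middle half of the window the tent has height at least [d / 2]. *)
have Nyge : ((m * (d / 2) * (x + d / 2 - (x - d / 2)) `^ p^-1)%:E <= Lnorm mu p%:E (EFin \o y))%E.
  apply: Lnorm_ge_itv => //.
  - by rewrite mulr_ge0 ?expR_ge0// divr_ge0// ltW.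
  - by lra.
  - move=> t /andP[t1 t2]; rewrite /y normrM (ger0_norm (expR_ge0 _)).
    have td : `|t - x| <= d / 2 by rewrite ler_norml; apply/andP; split; lra.
    apply: ler_pM; rewrite ?expR_ge0//; [lra|apply: Ege; lra|].
    by rewrite tentE ?(le_trans td)//; [rewrite ger0_norm; lra|lra].
have := H f y (mem_Lfun _ _ mf (le_lt_trans Nf (ltry _))) (mem_Lfun _ _ my (le_lt_trans Nyle (ltry _))) sol.
move=> /(le_trans Nyge) Hle.
have : (c%:E * Lnorm mu p%:E (EFin \o f) <= c%:E * (m * expR A * (x + d - (x - d)) `^ p^-1)%:E)%E.
  by rewrite lee_pmul2l.
move=> /(le_trans Hle); rewrite -EFinM lee_fin.
have -> : x + d / 2 - (x - d / 2) = d by field.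
have -> : x + d - (x - d) = 2 * d by ring.
have := powR_gt0 p^-1 d0; set D := d `^ p^-1 => D0.
have : (2 * d) `^ p^-1 <= 2 * D.
  rewrite powRM ?(ltW d0)// ler_wpM2r ?(ltW D0)//.
  by rewrite -[leRHS]powRr1// ler_powR// ?ler1n// invf_le1.
have : 0 < expR A by apply: expR_gt0.
set E := expR A; set K := (2 * d) `^ p^-1 => E0 KD HK.
have h1 : c * (m * E * K) <= c * (m * E * (2 * D)).
  by rewrite !ler_wpM2l// ?mulr_ge0// ltW.
have h2 := le_trans HK h1.
have mD : 0 < m * D by rewrite mulr_gt0.
have : (d / 2) * (m * D) <= (2 * c * E) * (m * D) by lra.
by rewrite ler_pM2r//; lra.
Qed.

Lemma solvable_diverges (p c : R) q : 1 <= p ->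
  locally_integrable [set: R] q -> (forall x, 0 <= q x) -> 0 < c ->
  (forall f y : R -> R, f \in Lfun mu p%:E -> y \in Lfun mu p%:E ->
     is_solution q f y ->
     (Lnorm mu p%:E (EFin \o y) <= c%:E * Lnorm mu p%:E (EFin \o f))%E) ->
  diverges q.
Proof.
move=> p1 lq q0 c0 H; apply/eqP; rewrite eq_le leey/= leNgt; apply/negP => fq.
have q0' : (0 <= \int[mu]_t (q t)%:E)%E.
  by apply: integral_ge0 => x _; rewrite lee_fin.
pose A := fine (\int[mu]_t (q t)%:E).
(* One more than the half-length bound allows, although every window carries at most the total mass
   [A]. *)
pose d := 4 * c * expR A + 1.
have B0 : 0 < 4 * c * expR A by rewrite !mulr_gt0 ?expR_gt0.
have d0 : 0 < d by rewrite /d; lra.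
have := solvable_half_length_le p c q p1 lq q0 c0 H 0 d A d0.
suff HA : prim q (0 + d) - prim q (0 - d) <= A by move=> /(_ HA); rewrite /d; lra.
rewrite -lee_fin -integral_itv_prim//; last by lra.
rewrite /A fineK ?ge0_fin_numE//.
apply: ge0_subset_integral => //=.
  by apply/measurable_EFinP; case: lq.
by move=> t _; rewrite lee_fin.
Qed.

Lemma solvable_d_fun_le (p c : R) q : 1 <= p ->
  locally_integrable [set: R] q -> (forall x, 0 <= q x) -> 0 < c ->
  (forall f y : R -> R, f \in Lfun mu p%:E -> y \in Lfun mu p%:E ->
     is_solution q f y ->
     (Lnorm mu p%:E (EFin \o y) <= c%:E * Lnorm mu p%:E (EFin \o f))%E) ->
  forall x, d_fun q x <= 4 * c * expR 2.
Proof.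
move=> p1 lq q0 c0 H x.
have B0 : 0 < 4 * c * expR 2 by rewrite !mulr_gt0 ?expR_gt0.
rewrite /d_fun; set S := [set d | _].
(* If no half-length qualifies, [inf set0 = 0] satisfies the bound; otherwise any member of [S]
   bounds the infimum. *)
have [->|/set0P[d Sd]] := eqVneq S set0; first by rewrite inf0 ltW.
apply: (@le_trans _ _ d).
  by apply: ge_inf => //; exists 0 => e [].
case: Sd => d0 Id.
move: d0; rewrite le_eqVlt => /predU1P[<-|d0]; first exact: ltW.
apply: (solvable_half_length_le p c q p1 lq q0 c0 H x d 2 d0).
by move: Id; rewrite integral_itv_prim// => [[->]|]; lra.
Qed.

End NecessityBound.

(** * The half-length function *)

Section HalfLength.
Context {R : realType}.
Notation mu := (@lebesgue_measure R).
Implicit Types (q : R -> R) (x d : R).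

(** If every window centred at [x] had mass below 2, monotone convergence along the integer
    half-lengths would bound the total mass by 2. *)
Lemma diverges_prim_ge2 q x : locally_integrable [set: R] q ->
  (forall x, 0 <= q x) -> diverges q ->
  exists2 d, 0 <= d & 2 <= prim q (x + d) - prim q (x - d).
Proof.
move=> lq q0 dq; apply: contrapT => nd.
pose F (n : nat) := `[x - n%:R, x + n%:R]%classic.
have ndF : nondecreasing_seq F.
  move=> m n mn; have : m%:R <= n%:R :> R by rewrite ler_nat.
  by move=> h; rewrite subsetEset; apply: subset_itv; rewrite bnd_simp; lra.
have FT : \bigcup_i F i = setT.
  apply/seteqP; split => // y _.
  pose n := (Num.trunc `|y - x|).+1.
  exists n => //; rewrite /F /= in_itv/=.
  have : `|y - x| <= n%:R by rewrite ltW// truncnS_gt.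
  by rewrite ler_norml => /andP[? ?]; apply/andP; split; lra.
have cv : (\int[mu]_(t in F n) (q t)%:E @[n --> \oo] --> \int[mu]_t (q t)%:E)%E.
  rewrite -FT; apply: ge0_nondecreasing_set_cvg_integral => //.
  - by move=> n; exact: measurable_itv.
  - by move=> n; apply/measurable_EFinP; apply: measurable_funTS; case: lq.
  - by move=> n t _; rewrite lee_fin.
have : (\int[mu]_t (q t)%:E <= 2%:E)%E.
  rewrite -(cvg_lim _ cv)//; apply: lime_le; first by apply/cvg_ex; eexists; exact: cv.
  apply: nearW => n.
  have n0 : 0 <= n%:R :> R by exact: ler0n.
  rewrite /F integral_itv_prim//; last by lra.
  rewrite lee_fin leNgt; apply/negP => h.
  by apply: nd; exists n%:R => //; exact: ltW.
by rewrite dq leNgt ltry.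
Qed.

Lemma prim_window_continuous q x : locally_integrable [set: R] q ->
  continuous (fun d => prim q (x + d) - prim q (x - d)).
Proof.
move=> lq; have cQ := locally_ac_continuous _ (prim_ac q lq).
have cD : continuous (fun d : R => x + d).
  by move=> d; apply: cvgD; [exact: cvg_cst|exact: cvg_id].
have cB : continuous (fun d : R => x - d).
  by move=> d; apply: cvgB; [exact: cvg_cst|exact: cvg_id].
move=> d; apply: (@continuousB _ _ _ (prim q \o (fun d => x + d)) (prim q \o (fun d => x - d))).
  by apply: continuous_comp; [exact: cD|exact: cQ].
by apply: continuous_comp; [exact: cB|exact: cQ].
Qed.

Lemma prim_window_le q x d e : locally_integrable [set: R] q ->
  (forall x, 0 <= q x) -> d <= e ->
  prim q (x + d) - prim q (x - d) <= prim q (x + e) - prim q (x - e).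
Proof.
by move=> lq q0 de; apply: lerB; apply: prim_le => //; lra.
Qed.

Lemma d_fun_set q x : locally_integrable [set: R] q ->
  [set d : R | 0 <= d /\
    (\int[mu]_(xi in `[(x - d)%R, (x + d)%R]) (q xi)%:E = 2%:E)%E] =
  [set d : R | 0 <= d /\ prim q (x + d) - prim q (x - d) = 2].
Proof.
move=> lq; apply/seteqP; split => d /= [d0]; rewrite integral_itv_prim//; [by move=> []|lra|by move=> ->|lra].
Qed.

(** Intermediate value theorem, between the degenerate window and one of mass at least 2. *)
Lemma d_fun_set_nonempty q x : locally_integrable [set: R] q ->
  (forall x, 0 <= q x) -> diverges q ->
  exists d, 0 <= d /\ prim q (x + d) - prim q (x - d) = 2.
Proof.
move=> lq q0 dq.
have [e e0 He] := diverges_prim_ge2 q x lq q0 dq.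
have cw : {within `[0, e], continuous (fun d => prim q (x + d) - prim q (x - d))}.
  by apply: continuous_subspaceT; exact: prim_window_continuous.
have [|d] := IVT e0 cw (v := 2).
  rewrite addr0 subr0 subrr; apply/andP; split.
    by rewrite ge_min ler0n.
  by rewrite le_max He orbT.
by rewrite in_itv/= => /andP[d0 _] dE; exists d.
Qed.

(** The mass of a window depends continuously on its half-length and is 0 at 0, so the value 2 is
    not reached near 0. *)
Lemma d_fun_gt0 q x : locally_integrable [set: R] q ->
  (forall x, 0 <= q x) -> diverges q -> 0 < d_fun q x.
Proof.
move=> lq q0 dq; rewrite /d_fun d_fun_set//.
have [d1 Hd1] := d_fun_set_nonempty q x lq q0 dq.
have := prim_window_continuous q x lq 0.
move=> /cvgrPdist_lt /(_ 2 (ltr0Sn _ 1))[r /= r0 Hr].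
apply: (@lt_le_trans _ _ (r / 2)); first by rewrite divr_gt0.
apply: lb_le_inf; first by exists d1.
move=> d /= [d0 dE]; rewrite leNgt; apply/negP => dr.
have dr' : `|0 - d| < r by rewrite sub0r normrN ger0_norm//; lra.
by have := Hr d dr'; rewrite dE addr0 subr0 subrr sub0r normrN gtr0_norm// ltxx.
Qed.

(** The strict inequality yields an admissible half-length below [D], so it is not necessary to know
    that the infimum is attained. *)
Lemma prim_window_ge2 q x D : locally_integrable [set: R] q ->
  (forall x, 0 <= q x) -> diverges q -> d_fun q x < D ->
  2 <= prim q (x + D) - prim q (x - D).
Proof.
move=> lq q0 dq; rewrite /d_fun d_fun_set// => dD.
have [d1 [d10 Hd1]] := d_fun_set_nonempty q x lq q0 dq.
have hi : has_inf [set d : R | 0 <= d /\ prim q (x + d) - prim q (x - d) = 2].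
  by split; [exists d1|exists 0 => e []].
have [d [d0 dE] dlt] := inf_adherent (ltr01 : 0 < (1 : R)) hi.
have [e [e0 eE] elt] : exists2 e, 0 <= e /\ prim q (x + e) - prim q (x - e) = 2 & e < D.
  apply: contrapT => h.
  have : D <= inf [set d : R | 0 <= d /\ prim q (x + d) - prim q (x - d) = 2].
    apply: lb_le_inf; first by exists d1.
    move=> e He; rewrite leNgt; apply/negP => eD; apply: h; by exists e.
  by rewrite leNgt dD.
by rewrite -eE; apply: prim_window_le => //; exact: ltW.
Qed.

(** Cut [[x, t]] into pieces of length [2 * D]: each full piece adds at least 2 to the primitive,
    and the incomplete last one costs at most the correction 2. *)
Lemma prim_linear_growth q D : locally_integrable [set: R] q ->
  (forall x, 0 <= q x) -> 0 < D ->
  (forall x, 2 <= prim q (x + D) - prim q (x - D)) ->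
  forall x t, x <= t -> (t - x) / D - 2 <= prim q t - prim q x.
Proof.
move=> lq q0 D0 H x t.
have : (t - x) / (2 * D) <= (Num.trunc `|(t - x) / (2 * D)|).+1%:R.
  by rewrite (le_trans (ler_norm _))// ltW// truncnS_gt.
(* Induction on a bound [n] for the number of pieces, with the left endpoint [x] moving right by
   [2 * D]. *)
move: (Num.trunc _).+1 => n; elim: n x => [|n IH] x Hn xt.
  move: Hn; rewrite ler_pdivrMr ?mulr_gt0// mul0r => Hn.
  have -> : t = x by lra.
  by rewrite !subrr mul0r; lra.
(* For a short interval the left-hand side is nonpositive and monotonicity of [prim q] suffices. *)
have [small|big] := leP (t - x) (2 * D).
  have : (t - x) / D <= 2 by rewrite ler_pdivrMr.
  have := prim_le q x t lq q0 xt; lra.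
have := IH (x + 2 * D); have := H (x + D).
have -> : x + D + D = x + 2 * D by ring.
have -> : x + D - D = x by ring.
have -> : (t - (x + 2 * D)) / (2 * D) = (t - x) / (2 * D) - 1.
  by field; rewrite gt_eqF.
have -> : (t - (x + 2 * D)) / D = (t - x) / D - 2 by field; rewrite gt_eqF.
have E : n.+1%:R = n%:R + 1 :> R by rewrite natr1.
rewrite E in Hn.
have Hn' : (t - x) / (2 * D) - 1 <= n%:R by lra.
by move=> h /(_ Hn'); lra.
Qed.

End HalfLength.

(** * The one-sided exponential kernel *)

Section Kernel.
Context {R : realType}.
Notation mu := (@lebesgue_measure R).
Implicit Types (D x t p s a : R).

(** Restricted to [x <= t], this is a probability density in each variable separately: in [t] for
    Jensen's inequality, in [x] for Tonelli's theorem. *)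
Definition exp_kernel D x t : R := D^-1 * expR (D^-1 * (x - t)).

Lemma exp_kernel_ge0 D x t : 0 < D -> 0 <= exp_kernel D x t.
Proof. by move=> D0; rewrite mulr_ge0 ?expR_ge0// invr_ge0 ltW. Qed.

Lemma exp_kernel_is_derive D x t :
  is_derive t (1 : R) (fun t => - expR (D^-1 * (x - t))) (exp_kernel D x t).
Proof.
have d1 : is_derive t (1 : R) (D^-1 \*: (cst x - id)) (D^-1 *: (0 - 1)).
  by apply: is_deriveZ; apply: is_deriveB.
have d2 : is_derive t (1 : R) (expR \o (D^-1 \*: (cst x - id)))
    (expR (D^-1 * (x - t)) * (D^-1 *: (0 - 1))).
  exact: is_derive1_comp.
have := is_deriveN d2.
rewrite (_ : - (_ * _) = exp_kernel D x t)//.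
by rewrite sub0r /exp_kernel /GRing.scale/=; ring.
Qed.

Lemma exp_kernel_continuousr D x : continuous (exp_kernel D x).
Proof.
have -> : exp_kernel D x = (- D^-1) \*: (fun t => - expR (D^-1 * (x - t))).
  by apply/funext => t; rewrite /exp_kernel /= /GRing.scale/= mulrNN.
move=> t; apply: differentiable_continuous; apply/derivable1_diffP.
apply: derivableZ.
by have [] := exp_kernel_is_derive D x t.
Qed.

Lemma expR_kernel_cvg D x : 0 < D ->
  - expR (D^-1 * (x - t)) @[t --> +oo] --> (0 : R).
Proof.
move=> D0; rewrite -oppr0; apply: cvgN.
have -> : (fun t => expR (D^-1 * (x - t))) =
    (fun t => expR (D^-1 * x) * ((fun z => expR (- z)) \o (fun t => D^-1 * t)) t).
  by apply/funext => t /=; rewrite -expRD; congr expR; ring.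
rewrite -(mulr0 (expR (D^-1 * x))); apply: cvgMr.
apply: (@cvg_comp _ _ _ _ _ _ (pinfty_nbhs R)); last exact: cvgr_expR.
by apply: gt0_cvgMry; rewrite ?invr_gt0.
Qed.

Lemma integral_exp_kernelr D x : 0 < D ->
  (\int[mu]_(t in `[x, +oo[) (exp_kernel D x t)%:E = 1)%E.
Proof.
move=> D0.
rewrite (@ge0_continuous_FTC2y _ _ (fun t => - expR (D^-1 * (x - t))) _ 0).
- by rewrite subrr mulr0 expR0 EFinN oppeK add0e.
- by move=> t _; exact: exp_kernel_ge0.
- by apply: continuous_subspaceT; exact: exp_kernel_continuousr.
- exact: expR_kernel_cvg.
- by move=> t _; have [] := exp_kernel_is_derive D x t.
- apply: cvg_at_right_filter.
  have : {for x, continuous (fun t => - expR (D^-1 * (x - t)))}; last by [].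
  apply: differentiable_continuous; apply/derivable1_diffP.
  by have [] := exp_kernel_is_derive D x x.
- by move=> t _; rewrite derive1E; have [_ ->] := exp_kernel_is_derive D x t.
Qed.

(** Reflection exchanges the two variables and transfers the facts about [t] to [x]. *)
Lemma exp_kernelN D x t : exp_kernel D (- x) (- t) = exp_kernel D t x.
Proof. by rewrite /exp_kernel opprK addrC. Qed.

Lemma exp_kernel_continuousl D t : continuous (exp_kernel D ^~ t).
Proof.
have -> : exp_kernel D ^~ t = exp_kernel D (- t) \o -%R.
  by apply/funext => x /=; rewrite exp_kernelN.
move=> x; apply: continuous_comp; last exact: exp_kernel_continuousr.
exact: opp_continuous.
Qed.

Lemma integral_exp_kernell D t : 0 < D ->
  (\int[mu]_(x in `]-oo, t]) (exp_kernel D x t)%:E = 1)%E.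
Proof.
move=> D0.
rewrite -(opprK t) ge0_integration_by_substitutionNy.
- rewrite -(integral_exp_kernelr D (- t) D0); apply: eq_integral => x _.
  by rewrite /= exp_kernelN.
- by apply: continuous_subspaceT; rewrite opprK; exact: exp_kernel_continuousl.
- by move=> x _; exact: exp_kernel_ge0.
Qed.

Lemma powR_tangent p s a : 1 <= p -> 0 < s -> 0 <= a ->
  p * s `^ (p - 1) * a <= a `^ p + (p - 1) * s `^ p.
Proof.
rewrite le_eqVlt => /predU1P[<- s0 a0|p1 s0 a0].
  by rewrite subrr powRr0 mul0r addr0 powRr1// !mul1r.
have p0 : 0 < p by lra.
have p10 : 0 < p - 1 by lra.
have := @conjugate_powR R a (s `^ (p - 1)) p (p / (p - 1)) a0 (powR_ge0 _ _) p0
  (divr_gt0 p0 p10).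
rewrite -powRrM mulrCA divff ?gt_eqF// mulr1.
have -> : p^-1 + (p / (p - 1))^-1 = 1 by field; rewrite !gt_eqF.
move=> /(_ erefl) h.
have -> : p * s `^ (p - 1) * a = p * (a * s `^ (p - 1)) by ring.
rewrite -ler_pdivlMl//; apply: (le_trans h).
by rewrite le_eqVlt; apply/orP; left; apply/eqP; field; rewrite !gt_eqF.
Qed.

(** Integrate the tangent inequality against the probability weight [w] and take [s] equal to the
    mean. *)
Lemma jensen_powR (A : set R) (w g : R -> R) p : 1 <= p -> measurable A ->
  measurable_fun A w -> measurable_fun A g ->
  (forall t, 0 <= w t) -> (forall t, 0 <= g t) ->
  (\int[mu]_(t in A) (w t)%:E = 1)%E ->
  ((\int[mu]_(t in A) (w t * g t)%:E) `^ p <=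
   \int[mu]_(t in A) (w t * g t `^ p)%:E)%E.
Proof.
move=> p1 mA mw mg w0 g0 w1.
have mwg : measurable_fun A (fun t => (w t * g t)%:E).
  by apply/measurable_EFinP; exact: measurable_funM.
have mwgp : measurable_fun A (fun t => (w t * g t `^ p)%:E).
  apply/measurable_EFinP; apply: measurable_funM => //.
  exact: (measurableT_comp (measurable_powR _)).
have p0 : 0 < p by lra.
set I := (\int[mu]_(t in A) (w t * g t)%:E)%E.
set J := (\int[mu]_(t in A) (w t * g t `^ p)%:E)%E.
have I0 : (0 <= I)%E by apply: integral_ge0 => t _; rewrite lee_fin mulr_ge0.
have J0 : (0 <= J)%E by apply: integral_ge0 => t _; rewrite lee_fin mulr_ge0 ?powR_ge0.
have key s : 0 < s -> ((p * s `^ (p - 1))%:E * I <= J + ((p - 1) * s `^ p)%:E)%E.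
  move=> s0.
  have -> : ((p - 1) * s `^ p)%:E = (((p - 1) * s `^ p)%:E * \int[mu]_(t in A) (w t)%:E)%E.
    by rewrite w1 mule1.
  have k1 : (0 <= (p * s `^ (p - 1))%:E)%E by rewrite lee_fin mulr_ge0 ?powR_ge0// ltW.
  have k2 : (0 <= ((p - 1) * s `^ p)%:E)%E by rewrite lee_fin mulr_ge0 ?powR_ge0// subr_ge0.
  have i1 t : A t -> (0 <= (w t * g t)%:E)%E by rewrite lee_fin mulr_ge0.
  have i2 t : A t -> (0 <= (w t)%:E)%E by rewrite lee_fin.
  have mw' : measurable_fun A (EFin \o w) by exact/measurable_EFinP.
  rewrite /I /J -(ge0_integralZl mu mA mwg i1 k1) -(ge0_integralZl mu mA mw' i2 k2).
  rewrite -ge0_integralD//; last 3 first.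
  - by move=> t _; rewrite lee_fin mulr_ge0 ?powR_ge0.
  - by move=> t _; rewrite lee_fin !mulr_ge0 ?powR_ge0//; lra.
  - by apply/measurable_EFinP; exact: measurable_funM.
  apply: ge0_le_integral => //.
  - by move=> t _; rewrite lee_fin !mulr_ge0 ?powR_ge0//; lra.
  - by apply/measurable_EFinP; apply: measurable_funM => //; exact: measurable_funM.
  - apply: emeasurable_funD => //.
    by apply/measurable_EFinP; exact: measurable_funM.
  - move=> t _; rewrite lee_fin.
    have := ler_wpM2l (w0 t) (powR_tangent p s (g t) p1 s0 (g0 t)).
    by congr (_ <= _); ring.
(* A zero mean is trivial, a finite positive mean [i] is used as [s], and for an infinite mean
   [s = 1] already forces [J] to be infinite. *)
move: I0 key; case: I => [i| |]//.
- rewrite lee_fin le_eqVlt => /predU1P[<- _|i0 /(_ i i0)].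
    by rewrite poweR0r ?gt_eqF.
  rewrite poweR_EFin; move: J0; case: J => [j _|_ _|]; last by rewrite leNgt ltNy0.
    rewrite -EFinM -EFinD !lee_fin.
    have -> : p * i `^ (p - 1) * i = p * i `^ p.
      by rewrite -mulrA -{2}(powRr1 (ltW i0)) -powRD ?subrK// (gt_eqF p0).
    by lra.
  by rewrite leey.
- move=> _ /(_ 1 ltr01).
  rewrite powR1 mulr1 gt0_muley ?lte_fin// => h.
  suff -> : J = +oo%E by rewrite leey.
  move: h J0; case: J => [j| |]//.
Qed.

End Kernel.

(** * The exponential averaging operator on L_p *)

Section Convolution.
Context {R : realType}.
Notation mu := (@lebesgue_measure R).
Implicit Types (D x t p C : R) (f y : R -> R).

(** The Tonelli integrand, extended by 0 from the half-plane [z.1 <= z.2] to the whole plane so that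
    both iterated integrals run over the full line. *)
Let H D p f (z : R * R) : \bar R :=
  (if z.1 <= z.2 then exp_kernel D z.1 z.2 * `|f z.2| `^ p else 0)%:E.

Let H_ge0 D p f z : 0 < D -> (0 <= H D p f z)%E.
Proof.
move=> D0; rewrite /H lee_fin; case: ifP => // _.
by rewrite mulr_ge0 ?exp_kernel_ge0 ?powR_ge0.
Qed.

Let measurable_H D p f : measurable_fun [set: R] f ->
  measurable_fun [set: R * R] (H D p f).
Proof.
move=> mf; apply/measurable_EFinP; apply: measurable_fun_ifT => //.
  by apply: measurable_fun_ler; [exact: measurable_fst|exact: measurable_snd].
apply: measurable_funM.
  apply: measurable_funM; first exact: measurable_cst.
  apply: (@measurableT_comp _ _ _ _ _ _ expR); first exact: measurable_expR.
  apply: measurable_funM; first exact: measurable_cst.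
  by apply: measurable_funB; [exact: measurable_fst|exact: measurable_snd].
apply: (measurableT_comp (measurable_powR _)) => //.
apply: measurableT_comp => //.
exact: (measurableT_comp mf measurable_snd).
Qed.

Let integral_Hr D p f x :
  (\int[mu]_t H D p f (x, t) =
   \int[mu]_(t in `[x, +oo[) (exp_kernel D x t * `|f t| `^ p)%:E)%E.
Proof.
rewrite [RHS]integral_mkcond; apply: eq_integral => t _.
by rewrite /H patchE mem_setE in_itv/= andbT; case: ifP.
Qed.

Let integral_Hl D p f t : 0 < D ->
  (\int[mu]_x H D p f (x, t) = (`|f t| `^ p)%:E)%E.
Proof.
move=> D0.
have -> : (\int[mu]_x H D p f (x, t) =
    \int[mu]_(x in `]-oo, t]) ((`|f t| `^ p)%:E * (exp_kernel D x t)%:E))%E.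
  rewrite [RHS]integral_mkcond; apply: eq_integral => x _.
  by rewrite /H patchE mem_setE in_itv/=; case: ifP => // _; rewrite -EFinM mulrC.
have mk : measurable_fun [set: R] (fun x => exp_kernel D x t).
  apply: continuous_measurable_fun; exact: exp_kernel_continuousl.
rewrite ge0_integralZl//.
- by rewrite integral_exp_kernell// mule1.
- by apply/measurable_EFinP; exact: measurable_funTS.
- by move=> x _; rewrite lee_fin exp_kernel_ge0.
Qed.

Lemma Lnorm_exp_kernel_le p D C f y : 1 <= p -> 0 < D -> 0 <= C ->
  measurable_fun [set: R] f -> measurable_fun [set: R] y ->
  (forall x, (`|y x|%:E <=
     C%:E * \int[mu]_(t in `[x, +oo[) (exp_kernel D x t * `|f t|)%:E)%E) ->
  (Lnorm mu p%:E (EFin \o y) <= C%:E * Lnorm mu p%:E (EFin \o f))%E.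
Proof.
move=> p1 D0 C0 mf my Hy.
have p0 : 0 < p by lra.
(* Jensen's inequality with the weight [exp_kernel D x] on [[x, +oo[]. *)
have pw x : ((`|y x| `^ p)%:E <= (C `^ p)%:E * \int[mu]_t H D p f (x, t))%E.
  rewrite integral_Hr -poweR_EFin.
  apply: (@le_trans _ _ ((C%:E * \int[mu]_(t in `[x, +oo[) (exp_kernel D x t * `|f t|)%:E) `^ p)%E).
    apply: gt0_ler_poweR; rewrite ?(ltW p0)// in_itv/= ?leey ?andbT ?lee_fin//.
    by apply: le_trans (Hy x); rewrite lee_fin.
  have I0 : (0 <= \int[mu]_(t in `[x, +oo[) (exp_kernel D x t * `|f t|)%:E)%E.
    by apply: integral_ge0 => t _; rewrite lee_fin mulr_ge0 ?exp_kernel_ge0.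
  rewrite poweRM// poweR_EFin; apply: lee_wpmul2l; first by rewrite lee_fin powR_ge0.
  apply: jensen_powR => //.
  - by apply: measurable_funTS; apply: continuous_measurable_fun; exact: exp_kernel_continuousr.
  - by apply: measurable_funTS; exact: measurableT_comp.
  - by move=> t; exact: exp_kernel_ge0.
  - exact: integral_exp_kernelr.
(* After the exchange, the inner integral in [x] of the kernel is 1. *)
have IH : (\int[mu]_x \int[mu]_t H D p f (x, t) = \int[mu]_t (`|f t| `^ p)%:E)%E.
  rewrite (@fubini_tonelli _ _ _ _ _ mu mu (H D p f)).
  - by apply: eq_integral => t _; exact: integral_Hl.
  - exact: measurable_H.
  - by move=> z; exact: H_ge0.
have mF : measurable_fun [set: R] (fun x => \int[mu]_t H D p f (x, t))%E.
  apply: (@measurable_fun_fubini_tonelli_F _ _ _ _ _ mu (H D p f)).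
    exact: measurable_H.
  by move=> z; exact: H_ge0.
rewrite !Lnorm_powR.
have -> : C%:E = ((C `^ p)%:E `^ p^-1)%E.
  by rewrite poweR_EFin -powRrM mulfV ?powRr1// gt_eqF.
rewrite -poweRM ?lee_fin ?powR_ge0//; last first.
  by apply: integral_ge0 => t _; rewrite lee_fin powR_ge0.
have If0 : (0 <= \int[mu]_x (`|f x| `^ p)%:E)%E.
  by apply: integral_ge0 => t _; rewrite lee_fin powR_ge0.
apply: gt0_ler_poweR; rewrite ?invr_ge0 ?(ltW p0)// ?in_itv/= ?leey ?andbT.
- by apply: integral_ge0 => t _; rewrite lee_fin powR_ge0.
- by rewrite mule_ge0// lee_fin powR_ge0.
rewrite -IH -ge0_integralZl//.
- apply: ge0_le_integral => //.
  + exact: measurable_normr_powR.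
  + exact: emeasurable_funM.
- by move=> x _; apply: integral_ge0 => t _; exact: H_ge0.
- by rewrite lee_fin powR_ge0.
Qed.

End Convolution.

(** * Sufficiency *)

Section Sufficiency.
Context {R : realType}.
Notation mu := (@lebesgue_measure R).
Implicit Types (D x y t p : R) (q f z g : R -> R).

Lemma homogeneous_Lfun_eq0 p q z : 1 <= p -> locally_integrable [set: R] q ->
  (forall x, 0 <= q x) -> z \in Lfun mu p%:E -> is_solution q (fun=> 0) z ->
  forall x, z x = 0.
Proof.
move=> p1 lq q0 Lz sz.
have zE := homogeneous_solutionE q z lq sz.
suff z0 : z 0 = 0 by move=> x; rewrite zE z0 mul0r.
apply/eqP; apply: contraT => zn0; exfalso.
have p0 : 0 < p by lra.
have z0 : 0 < `|z 0| by rewrite normr_gt0.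
have mz := Lfun_measurable _ _ Lz.
have := Lfun_lty _ _ Lz.
move: (Lnorm_ge0 mu p%:E (EFin \o z)).
case E : (Lnorm mu p%:E (EFin \o z)) => [N| |]//; rewrite lee_fin => N0 _.
pose n := ((N + 1) / `|z 0|) `^ p.
have := Lnorm_ge_itv p 0 n `|z 0| z p1 (ltW z0) (powR_ge0 _ _) mz.
rewrite E subr0 /n -powRrM mulfV ?gt_eqF// powRr1; last first.
  by rewrite divr_ge0// addr_ge0.
rewrite [X in X%:E]mulrC divfK ?gt_eqF// lee_fin => H.
have : N + 1 <= N; last by lra.
apply: H => x /andP[x0 _]; rewrite (zE x) normrM (ger0_norm (expR_ge0 _)).
rewrite ler_peMr// -expR0 ler_expR -(prim0 q).
exact: prim_le.
Qed.

(** A compact set is bounded below, hence contained in some half-line [[- m, +oo[]. *)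
Lemma locally_integrable_tail g : measurable_fun [set: R] g ->
  (forall x, mu.-integrable `[x, +oo[ (EFin \o g)) ->
  locally_integrable [set: R] g.
Proof.
move=> mg ig; split => //; first exact: openT.
move=> K _ cK.
have [M [Mr HM]] := compact_bounded cK.
pose m := Num.max M 0 + 1.
have Km : K `<=` `[- m, +oo[.
  move=> t Kt /=; rewrite in_itv/= andbT.
  have Mm : M < m by rewrite /m; have := le_max M M 0; rewrite lexx/=; lra.
  by have := HM m Mm t Kt; rewrite /= ler_norml => /andP[].
have /integrableP[_] := ig (- m).
apply: le_lt_trans; apply: ge0_subset_integral => //=.
- exact: compact_measurable.
- by apply/measurable_EFinP; apply: measurable_funTS; exact: measurableT_comp.
Qed.

Lemma Rintegral_tailB g x y : (forall x, mu.-integrable `[x, +oo[ (EFin \o g)) ->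
  x <= y -> \int[mu]_(t in `[x, +oo[) g t - \int[mu]_(t in `[y, +oo[) g t =
  \int[mu]_(t in `[x, y]) g t.
Proof.
move=> ig xy.
have := @Rintegral_itvB R g (BLeft x) +oo%O y (ig x).
rewrite !bnd_simp => /(_ xy isT).
rewrite (@Rintegral_itv_obnd_cbnd R y +oo%O g) => [<-|]; first by ring.
apply: integrableS (ig y) => //.
by apply: subset_itvr; rewrite bnd_simp.
Qed.

(** * Variation of constants from plus infinity *)

Section Duhamel.
Variables (p D : R) (q f : R -> R).
Hypotheses (p1 : 1 <= p) (D0 : 0 < D) (lq : locally_integrable [set: R] q).
Hypothesis growth : forall x t, x <= t -> (t - x) / D - 2 <= prim q t - prim q x.
Hypothesis Lf : f \in Lfun mu p%:E.

Let g t := expR (- prim q t) * f t.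

Let mf : measurable_fun [set: R] f.
Proof. exact: Lfun_measurable Lf. Qed.

Let mg : measurable_fun [set: R] g.
Proof.
apply: measurable_funM => //; apply: continuous_measurable_fun.
have h : continuous (expR \o (- prim q)).
  move=> x; apply: continuous_comp; last exact: continuous_expR.
  by apply: continuousN; exact: (locally_ac_continuous _ (prim_ac q lq)).
exact: h.
Qed.

(** By [growth], [expR (prim q x - prim q t)] is at most [expR 2] times [expR (D^-1 * (x - t))]; the
    factor [D] undoes the normalisation of the kernel. *)
Let g_le x t : x <= t ->
  expR (prim q x) * `|g t| <= expR 2 * D * (exp_kernel D x t * `|f t|).
Proof.
move=> xt; rewrite /g normrM (ger0_norm (expR_ge0 _)) !mulrA ler_wpM2r//.
rewrite mulfK ?gt_eqF// -!expRD ler_expR.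
by have := growth x t xt; rewrite mulrBr [_ * t]mulrC [_ * x]mulrC; lra.
Qed.

Let normr_le1_powR (a : R) : `|a| <= 1 + `|a| `^ p.
Proof.
have [a1|a1] := leP `|a| 1; first by rewrite (le_trans a1)// lerDl powR_ge0.
by rewrite -[leLHS]powRr1// (le_trans (ler_powR (ltW a1) p1))// lerDr.
Qed.

(** The bound [|f| <= 1 + |f| ^ p] takes the place of Hölder's inequality: the kernel is integrable
    and at most [D^-1], so kernel times [|f|] is dominated by the kernel plus [D^-1 * |f| ^ p]. *)
Let ig x : mu.-integrable `[x, +oo[ (EFin \o g).
Proof.
pose G t := expR (- prim q x) * (expR 2 * D) * (exp_kernel D x t + D^-1 * `|f t| `^ p).
have iG : mu.-integrable `[x, +oo[ (EFin \o G).
  have -> : EFin \o G = (fun t => (expR (- prim q x) * (expR 2 * D))%:E * ((exp_kernel D x t)%:E + (D^-1)%:E * (`|f t| `^ p)%:E))%E.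
    by apply/funext => t.
  apply: integrableZl => //; apply: integrableD => //.
    apply/integrableP; split.
      apply/measurable_EFinP; apply: measurable_funTS.
      by apply: continuous_measurable_fun; exact: exp_kernel_continuousr.
    under eq_integral do rewrite gee0_abs ?lee_fin ?exp_kernel_ge0//.
    by rewrite integral_exp_kernelr// ltry.
  apply: integrableZl => //.
  by apply: (@integrableS _ _ _ mu setT) => //; exact: Lfun_integrable.
apply: le_integrable iG => //.
  by apply/measurable_EFinP; exact: measurable_funTS.
move=> t /=; rewrite in_itv/= andbT => xt.
have k0 := exp_kernel_ge0 D x t D0; have D0' := ltW D0.
have G0 : 0 <= G t.
  by rewrite /G mulr_ge0 ?addr_ge0 ?mulr_ge0 ?expR_ge0 ?powR_ge0 ?invr_ge0.
rewrite lee_fin (ger0_norm G0) /G -mulrA.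
have := ler_wpM2l (expR_ge0 (- prim q x)) (g_le x t xt).
rewrite [leLHS]mulrA -expRD addNr expR0 mul1r => /le_trans; apply.
rewrite ler_wpM2l ?expR_ge0// ler_wpM2l ?mulr_ge0 ?expR_ge0//.
apply: (le_trans (ler_wpM2l k0 (normr_le1_powR (f t)))).
rewrite mulrDr mulr1 lerD2l ler_wpM2r ?powR_ge0// /exp_kernel.
rewrite ler_piMr ?invr_ge0 ?(ltW D0)// -expR0 ler_expR.
by rewrite mulr_ge0_le0 ?invr_ge0 ?(ltW D0)// subr_le0.
Qed.

Let lg : locally_integrable [set: R] g.
Proof. exact: locally_integrable_tail mg ig. Qed.

Definition duhamel x := expR (prim q x) * \int[mu]_(t in `[x, +oo[) g t.

(** Writing the tail as a constant minus [prim g] transfers to it the regularity and the derivative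
    of [prim g]. *)
Let phiE x : \int[mu]_(t in `[x, +oo[) g t =
  \int[mu]_(t in `[0, +oo[) g t - prim g x.
Proof.
have [x0|/ltW x0] := leP 0 x.
  by have := Rintegral_tailB g 0 x ig x0; rewrite -primB// prim0; lra.
by have := Rintegral_tailB g x 0 ig x0; rewrite -primB// prim0; lra.
Qed.

Lemma duhamel_solution : is_solution q f duhamel.
Proof.
pose phi x := \int[mu]_(t in `[0, +oo[) g t - prim g x.
have -> : duhamel = (fun x => expR (prim q x) * phi x).
  by apply/funext => x; rewrite /duhamel phiE.
have -> : f = (fun x => - (expR (prim q x) * (- g x))).
  by apply/funext => x; rewrite /g mulrN opprK mulrA -expRD subrr expR0 mul1r.
apply: is_solution_expM => //.
  apply: (locally_acB (cst _)); last exact: prim_ac.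
  by apply: (locally_ac_lipschitz 0) => u v; rewrite subrr normr0 mul0r.
have := prim_derive g lg.
apply: (@filterS _ _ (ae_filter_ringOfSetsType mu)) => x dg.
have dc := @is_derive_cst R R R (\int[mu]_(t in `[0, +oo[) g t) (x : R) 1.
have := is_deriveB dc dg.
by rewrite sub0r.
Qed.

Lemma duhamel_Lnorm :
  (Lnorm mu p%:E (EFin \o duhamel) <=
   (expR 2 * D)%:E * Lnorm mu p%:E (EFin \o f))%E.
Proof.
apply: (Lnorm_exp_kernel_le p D) => //.
- by rewrite mulr_ge0 ?expR_ge0// ltW.
- by apply: locally_ac_measurable; case: duhamel_solution.
move=> x.
have mk : measurable_fun [set: R] (fun t => exp_kernel D x t * `|f t|).
  apply: measurable_funM; last exact: measurableT_comp.
  by apply: continuous_measurable_fun; exact: exp_kernel_continuousr.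
rewrite /duhamel normrM (ger0_norm (expR_ge0 _)) EFinM.
rewrite EFin_normr_Rintegral//.
apply: (@le_trans _ _ ((expR (prim q x))%:E * \int[mu]_(t in `[x, +oo[) `|g t|%:E)%E).
  apply: lee_wpmul2l; first by rewrite lee_fin expR_ge0.
  apply: le_abse_integral => //.
  by apply/measurable_EFinP; exact: measurable_funTS.
have mng : measurable_fun `[x, +oo[ (fun t => `|g t|%:E).
  by apply/measurable_EFinP; apply: measurable_funTS; exact: measurableT_comp.
have mk' : measurable_fun `[x, +oo[ (fun t => (exp_kernel D x t * `|f t|)%:E).
  by apply/measurable_EFinP; exact: measurable_funTS.
have C0 : 0 <= expR 2 * D by rewrite mulr_ge0 ?expR_ge0// ltW.
have mx : measurable `[x, +oo[ by exact: measurable_itv.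
have g0 (t : R) : `[x, +oo[%classic t -> (0 <= `|g t|%:E)%E by rewrite lee_fin.
have k0 (t : R) : `[x, +oo[%classic t -> (0 <= (exp_kernel D x t * `|f t|)%:E)%E.
  by rewrite lee_fin mulr_ge0 ?exp_kernel_ge0.
have C0' : (0 <= (expR 2 * D)%:E)%E by rewrite lee_fin.
have E0 : (0 <= (expR (prim q x))%:E)%E by rewrite lee_fin expR_ge0.
rewrite -(ge0_integralZl mu mx mng g0 E0) -(ge0_integralZl mu mx mk' k0 C0').
apply: ge0_le_integral => //.
- exact: measurable_funeM.
- exact: measurable_funeM.
- move=> t /=; rewrite in_itv/= andbT => xt.
  by rewrite -!EFinM lee_fin g_le.
Qed.

Lemma duhamel_Lfun : duhamel \in Lfun mu p%:E.
Proof.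
apply: mem_Lfun; first by apply: locally_ac_measurable; case: duhamel_solution.
apply: (le_lt_trans duhamel_Lnorm).
apply: lte_mul_pinfty => //; first by rewrite lee_fin mulr_ge0 ?expR_ge0// ltW.
exact: Lfun_lty.
Qed.

End Duhamel.

End Sufficiency.

(** * The equivalences *)

Section Main.
Context {R : realType}.
Notation mu := (@lebesgue_measure R).
Implicit Types (D x t p : R) (q f y z g : R -> R).

Lemma d0_lty q : (d0 q < +oo)%E -> exists2 B, 0 < B & forall x, d_fun q x <= B.
Proof.
move=> d0y.
have ub x : ((d_fun q x)%:E <= d0 q)%E by apply: ereal_sup_ubound; exists x.
have fd : d0 q \is a fin_num.
  by rewrite fin_numElt d0y andbT (lt_le_trans _ (ub 0)) ?ltNyr.
(* The maximum with 1 makes the bound positive, hence invertible. *)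
exists (Num.max (fine (d0 q)) 1); first by rewrite lt_max ltr01 orbT.
by move=> x; rewrite le_max -lee_fin fineK// ub.
Qed.

Lemma le_d0 q B : (forall x, d_fun q x <= B) -> (d0 q < +oo)%E.
Proof.
move=> dB; apply: (@le_lt_trans _ _ B%:E); last exact: ltry.
by apply: ge_ereal_sup => _ [x _ <-]; rewrite lee_fin.
Qed.

(** Inversion reverses order on positive numbers; positivity of [d_fun] excludes the default value
    [0^-1 = 0]. *)
Lemma d0_qstar0 q : (forall x, 0 < d_fun q x) ->
  (d0 q < +oo)%E <-> (0 < qstar0 q)%E.
Proof.
move=> dpos; split=> [/d0_lty[B B0 dB]|q0].
  apply: (@lt_le_trans _ _ (B^-1)%:E); first by rewrite lte_fin invr_gt0.
  apply: le_ereal_inf_tmp => _ [x _ <-].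
  by rewrite lee_fin /qstar lef_pV2 ?posrE.
have lb x : (qstar0 q <= (qstar q x)%:E)%E by apply: ereal_inf_lbound; exists x.
have fq : qstar0 q \is a fin_num.
  by rewrite ge0_fin_numE ?ltW// (le_lt_trans (lb 0))// ltry.
have m0 : 0 < fine (qstar0 q) by rewrite fine_gt0// q0 -ge0_fin_numE ?ltW.
apply: (@le_d0 _ (fine (qstar0 q))^-1) => x.
rewrite -[leLHS]invrK lef_pV2 ?posrE ?invr_gt0//.
by rewrite -lee_fin fineK// lb.
Qed.

Lemma correctly_solvableP p q : 1 <= p -> locally_integrable [set: R] q ->
  (forall x, 0 <= q x) ->
  correctly_solvable p q <-> diverges q /\ (d0 q < +oo)%E.
Proof.
move=> p1 lq q0; split=> [[_ [c c0 Hc]]|[dq /d0_lty[B B0 dB]]].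
  split; first exact: (solvable_diverges p c).
  exact: (le_d0 _ _ (solvable_d_fun_le p c q p1 lq q0 c0 Hc)).
(* Strictly above every [d_fun q x], as [prim_window_ge2] requires. *)
pose D := B + 1.
have D0 : 0 < D by rewrite /D; lra.
have G : forall x t, x <= t -> (t - x) / D - 2 <= prim q t - prim q x.
  apply: prim_linear_growth => // x; apply: prim_window_ge2 => //.
  by rewrite /D; have := dB x; lra.
have uniq f y1 y2 : y1 \in Lfun mu p%:E -> is_solution q f y1 ->
    y2 \in Lfun mu p%:E -> is_solution q f y2 -> y1 = y2.
  move=> L1 s1 L2 s2; apply/funext => x; apply/eqP; rewrite -subr_eq0; apply/eqP.
  apply: (homogeneous_Lfun_eq0 p q (y1 \- y2) p1 lq q0 _ (is_solutionB _ _ _ _ s1 s2)).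
  have p1' : (1 <= p%:E)%E by rewrite lee_fin.
  have [_ LD] := Lfun_addr_closed mu p1'.
  have LN := Lfun_oppr_closed L2.
  exact: LD _ _ L1 LN.
split.
  move=> f Lf; exists (duhamel q f); split.
    by split; [exact: (duhamel_Lfun p D)|exact: (duhamel_solution p D)].
  move=> y [Ly sy]; apply: (uniq f) => //.
    exact: (duhamel_Lfun p D).
  exact: (duhamel_solution p D).
exists (expR 2 * D); first by rewrite mulr_gt0 ?expR_gt0.
move=> f y Lf Ly sy.
(* By uniqueness, the estimate for the Duhamel solution covers every solution in L_p. *)
have -> : y = duhamel q f.
  apply: (uniq f) => //.
    exact: (duhamel_Lfun p D).
  exact: (duhamel_solution p D).
exact: (duhamel_Lnorm p D).
Qed.

Lemma locally_integrable_norm q : locally_integrable [set: R] q ->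
  locally_integrable [set: R] (fun x => `|q x|).
Proof.
move=> [mq oT iq]; split => //; first exact: measurableT_comp.
by move=> K KT cK; under eq_integral do rewrite normr_id; exact: iq.
Qed.

(** * Reduction to a coefficient that is nonnegative everywhere *)

Section AeNonneg.
Variable q : R -> R.
Hypothesis lq : locally_integrable [set: R] q.
Hypothesis q_ge0 : {ae mu, forall x, 0 <= q x}.

(** As [q] equals its absolute value almost everywhere, divergence and [d_fun], being defined
    through integrals of [q], are unchanged by the replacement. *)
Lemma integral_norm_ae (A : set R) : measurable A ->
  (\int[mu]_(t in A) (q t)%:E = \int[mu]_(t in A) `|q t|%:E)%E.
Proof.
move=> mA; have mq : measurable_fun A q by case: lq => mq _ _; exact: measurable_funTS.
apply: ae_eq_integral => //.
- exact/measurable_EFinP.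
- by apply/measurable_EFinP; exact: measurableT_comp.
- move: q_ge0; apply: (@filterS _ _ (ae_filter_ringOfSetsType mu)) => x qx _.
  by rewrite /= ger0_norm.
Qed.

Lemma diverges_norm : diverges q = diverges (fun x => `|q x|).
Proof. by congr (_ = _); apply: integral_norm_ae. Qed.

Lemma d_fun_norm : d_fun q = d_fun (fun x => `|q x|).
Proof.
apply/funext => x; rewrite /d_fun; congr inf; apply/funext => d.
congr (_ /\ _ = _); apply: integral_norm_ae; exact: measurable_itv.
Qed.

Lemma is_solution_norm : is_solution q = is_solution (fun x => `|q x|).
Proof.
apply/funext => f; apply/funext => y; apply/propext; split=> -[ac s];
  split => //; move: q_ge0 s;
  by apply: (@filterS2 _ _ (ae_filter_ringOfSetsType mu)) => x /ger0_norm ->.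
Qed.

Lemma correctly_solvable_norm p :
  correctly_solvable p q = correctly_solvable p (fun x => `|q x|).
Proof. by rewrite /correctly_solvable is_solution_norm. Qed.

End AeNonneg.
End Main.

Theorem theorem1p3 (R : realType) (p : R) (q : R -> R)
    (p_ge1 : 1 <= p)
    (q_loc : locally_integrable [set: R] q)
    (q_ge0 : {ae (@lebesgue_measure R), forall x, 0 <= q x}) :
  (correctly_solvable p q <-> diverges q /\ (d0 q < +oo)%E) /\
  (diverges q -> ((d0 q < +oo)%E <-> (0 < qstar0 q)%E)).
Proof.
(* All notions are transferred to the absolute value of [q], which is nonnegative at every point. *)
have lq := locally_integrable_norm _ q_loc.
have nq x : 0 <= `|q x| by exact: normr_ge0.
have d0E : d0 q = d0 (fun x => `|q x|) by rewrite /d0 d_fun_norm.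
split.
  by rewrite correctly_solvable_norm// diverges_norm// d0E; exact: correctly_solvableP.
rewrite diverges_norm// => dq; apply: d0_qstar0 => x.
by rewrite d_fun_norm//; exact: d_fun_gt0.
Qed.
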